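(* Let $(X,d)$ be a nonempty compact metric space and let $\mathcal{F}\subseteq\mathcal{C}(X,X)$. Assume that $\mathcal{F}$ can be covered by countably many compact sets $\mathcal{N}\subseteq\mathcal{C}(X,X)$ each having uniformly controlled powers. Then $\mathcal{F}$ admits a common extension defined on $2^{\mathbb{N}}$; that is, there exists a continuous map $U_{\mathcal{F}}:2^{\mathbb{N}}\to 2^{\mathbb{N}}$ such that every $T\in\mathcal{F}$ is a factor of $U_{\mathcal{F}}$.
   Context: $\mathcal{C}(X,X)$ is the space of continuous maps from $X$ to $X$ with the topology of uniform convergence (sup metric). $2^{\mathbb{N}}$ is the Cantor space. A family $\mathcal{N}\subseteq\mathcal{C}(X,X)$ has uniformly controlled powers if the sequence of maps $\mathcal{N}\ni S\mapsto S^i=S\circ\cdots\circ S$ ($i$ times), $i\ge 0$ (with $S^0=\mathrm{id}$), from $\mathcal{N}$ to $\mathcal{C}(X,X)$ is pointwise equicontinuous; in other words, whenever a sequence $(S_k)\subseteq\mathcal{N}$ converges to some $S\in\mathcal{N}$, one has $S_k^i(x)\to S^i(x)$ as $k\to\infty$, uniformly with respect to $x\in X$ and $i\ge 0$. A continuous self-map $T:X\to X$ is a factor of a continuous self-map $S:E\to E$ if there is a continuous map $\pi$ from $E$ onto $X$ with $T\pi=\pi S$. *)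

(* Defs.v *)
From HB Require Import structures.
From mathcomp Require Import all_boot all_order all_algebra.
From mathcomp Require Import all_classical all_reals all_analysis.

Set Implicit Arguments.
Unset Strict Implicit.
Unset Printing Implicit Defensive.

(* Equips [continuousType X X] with the topology of uniform convergence. *)
Import ArrowAsUniformType.

Local Open Scope classical_set_scope.

(* [equicontinuous] requires a pointed codomain; the point plays no role. *)
HB.instance Definition _ (X : uniformType) :=
  isPointed.Build (continuousType X X) (@idfun X).

Lemma continuous_iter (X : topologicalType) (S : continuousType X X) (i : nat) :
  continuous (iter i S).
Proof.
elim: i => [|i IHi] x; first exact: cvg_id.
by apply: (@continuous_comp _ _ _ (iter i S) S); [exact: IHi|exact: cts_fun].
Qed.

Definition cts_iter (X : topologicalType) (i : nat) (S : continuousType X X) :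
  continuousType X X := mkcts (@continuous_iter X S i).

(* The maps S |-> S^i are equicontinuous on N with its induced topology.
   [subspace N] carries the whole type, with the points outside N isolated, so
   the condition is void outside N. *)
Definition uniformly_controlled_powers (X : uniformType)
    (N : set (continuousType X X)) :=
  equicontinuous [set: nat]
    (fun i (S : subspace N) => cts_iter i (S : continuousType X X)).

Definition is_factor (X E : topologicalType)
    (T : continuousType X X) (S : continuousType E E) :=
  exists pi : continuousType E X,
    set_surj [set: E] [set: X] pi /\ T \o pi = pi \o S.

(* Main.v *)
Require Import Defs.
From HB Require Import structures.
From mathcomp Require Import all_boot all_order all_algebra.
From mathcomp Require Import all_classical all_reals all_analysis.

Import ArrowAsUniformType.
Import Order.TTheory GRing.Theory Num.Theory.

Set Implicit Arguments.
Unset Strict Implicit.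
Unset Printing Implicit Defensive.

Local Open Scope classical_set_scope.

(** Every point of an orbit of [T] has the form [T^i x], and the pair [(i, x)]
    does not mention [T].  So [A = nat * X] with the shift
    [sigma (i, x) = (i.+1, x)] is a single system that maps equivariantly onto
    each [(X, T)] by [(i, x) |-> T^i x].  The point is to compactify [A]
    metrizably so that all these maps, for [T] in [F], and [sigma] extend.

    Uniform control of the powers makes this possible.  By compactness, each
    piece of the cover is separable for the distance
    [sup_(i, x) d (S^i x, T^i x)], so there is one sequence [S_m] that comes
    close to every [T] in [F] for it ([powers_dense]).  Points of the compact
    metric space [X] can be coded by bit sequences, finitely many bits
    determining the point up to [e] ([bit_coding]).  Let [phi (i, x)] be the
    sequence of all bits of all the points [S_m^(j + i) x]: then [sigma] acts
    on [phi] by a reindexing of the bits, and finitely many bits of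
    [phi (i, x)] determine [T^i x] up to [e], for each [T] in [F].

    The closure [E] of the range of [phi] is the desired compactification.  It
    is a retract of the Cantor space, by a retraction [r]; following [r] by the
    reindexing gives [U], and precomposing the extensions [E -> X] with [r]
    gives the factor maps ([cantor_factor]). *)

(** * Finite prefixes of binary sequences *)

Definition agree (n : nat) (v w : nat -> bool) :=
  forall i, (i < n)%N -> v i = w i.

Lemma agree_sym n v w : agree n v w -> agree n w v.
Proof. by move=> vw i /vw. Qed.

Lemma agree_trans n u v w : agree n u v -> agree n v w -> agree n u w.
Proof. by move=> uv vw i iltn; rewrite uv// vw. Qed.

Lemma agreeW m n v w : (m <= n)%N -> agree n v w -> agree m v w.
Proof. by move=> mn vw i im; apply: vw; exact: leq_trans mn. Qed.

Lemma agree_reindex (s : nat -> nat) n :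
  exists m, forall v w, agree m v w -> agree n (v \o s) (w \o s).
Proof.
exists (\max_(i < n) (s i).+1)%N => v w vw i iltn /=; apply: vw.
exact: (leq_bigmax (F := fun i : 'I_n => (s i).+1) (Ordinal iltn)).
Qed.

Lemma nbhs_agree (w : cantor_space) n :
  nbhs w [set v : cantor_space | agree n v w].
Proof.
elim: n => [|n IHn]; first exact: filterS filterT.
have pn : nbhs w [set v : cantor_space | v n = w n].
  exact: (@proj_continuous nat (fun=> bool) n w _ (discrete_set1 (w n))).
apply: filterS2 IHn pn => v vw vwn i.
by rewrite ltnS leq_eqVlt => /orP[/eqP->|/vw].
Qed.

Lemma cantor_continuous (f : cantor_space -> cantor_space) :
  (forall n, exists m, forall v w, agree m v w -> agree n (f v) (f w)) ->
  continuous f.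
Proof.
move=> fP w; apply/cvg_sup => i U [_ [[V _ <-] Vfw]] VU.
have [m mP] := fP i.+1.
apply: filterS (nbhs_agree w m) => v /mP vw; apply: VU => /=.
by rewrite vw.
Qed.

(** * Retraction of the Cantor space onto the closure of a family *)

Section retract.
Context {A : choiceType} (phi : A -> nat -> bool) (a0 : A).

(** The closure of the range of [phi] in the Cantor space. *)
Definition prefixed : set (nat -> bool) :=
  [set w | forall n, exists a, agree n w (phi a)].

(** Walk down the tree of prefixes of the family, with [follow w n] a member of
    the family lying above the node reached at level [n].  The walk takes the
    branch of [w] whenever the family goes through it, and otherwise stays on
    the current member. *)
Fixpoint follow (w : nat -> bool) (n : nat) : A :=
  if n is m.+1 then
    let a := follow w m in
    xget a [set b | agree m (phi a) (phi b) /\ phi b m = w m]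
  else a0.

Definition retract (w : nat -> bool) : nat -> bool :=
  fun n => phi (follow w n.+1) n.

Lemma follow_agree w n : agree n (phi (follow w n)) (phi (follow w n.+1)).
Proof. by rewrite /=; case: xgetP => [b _ [] //|_ i]. Qed.

Lemma retract_agree w n : agree n (retract w) (phi (follow w n)).
Proof.
elim: n => [//|n IHn] i; rewrite ltnS leq_eqVlt => /orP[/eqP-> //|iltn].
by rewrite IHn// (@follow_agree w n i iltn).
Qed.

Lemma retract_prefixed w : prefixed (retract w).
Proof. by move=> n; exists (follow w n); exact: retract_agree. Qed.

(** As long as [w] has been followed exactly, the member of the family sharing
    one more bit with [w] shows that the branch of [w] is available. *)
Lemma retract_id w : prefixed w -> retract w = w.
Proof.
move=> wP.
have follow_w n : agree n w (phi (follow w n)).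
  elim: n => [//|n IHn].
  have [b wb] := wP n.+1.
  rewrite /=; case: xgetP => [c _ [ac cw]|/(_ b) []]; last first.
    split; last by rewrite wb.
    exact: agree_trans (agree_sym IHn) (agreeW (leqnSn n) wb).
  move=> i; rewrite ltnS leq_eqVlt => /orP[/eqP-> //|iltn].
  by rewrite IHn// ac.
by apply/funext => n; rewrite /retract -follow_w.
Qed.

Lemma retract_nonexpansive n v w :
  agree n v w -> agree n (retract v) (retract w).
Proof.
move=> vw.
have followE k : (k <= n)%N -> follow v k = follow w k.
  elim: k => [//|k IHk] kn /=; rewrite IHk 1?ltnW//; congr xget.
  by rewrite (vw _ kn).
by move=> i iltn; rewrite /retract followE.
Qed.

End retract.

(** * From a binary coding to a Cantor system *)

Lemma half_gt0 (R : realType) (e : R) : (0 < e -> 0 < e / 2)%R.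
Proof. by move=> e0; rewrite divr_gt0. Qed.

Section extension.
Context {R : realType} {X : metricType R} (X_compact : compact [set: X]).
Context {A : choiceType} (phi : A -> nat -> bool) (a0 : A).

(** Uniform continuity of [p] for the uniform structure that [phi] pulls back
    from the Cantor space. *)
Definition finitely_determined (p : A -> X) := forall e : R, (0 < e)%R ->
  exists n, forall a b, agree n (phi a) (phi b) -> ball (p a) e (p b).

(** Convergence of [p a] to [x] as [phi a] tends to [w]. *)
Definition limit_at (p : A -> X) (w : nat -> bool) (x : X) :=
  forall e : R, (0 < e)%R ->
  exists n, forall a, agree n w (phi a) -> ball x e (p a).

Lemma ball_eq (x y : X) : (forall e : R, (0 < e)%R -> ball x e y) -> x = y.
Proof.
move=> xy; apply: metric_hausdorff => B C /nbhs_ballP[e e0 xB].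
by move=> /nbhs_singleton Cy; exists y; split=> //; apply: xB; exact: xy.
Qed.

Lemma limit_at_phi p a : finitely_determined p -> limit_at p (phi a) (p a).
Proof. by move=> pP e /pP[n nP]; exists n => b; exact: nP. Qed.

Lemma limit_at_unique p w x y :
  prefixed phi w -> limit_at p w x -> limit_at p w y -> x = y.
Proof.
move=> wP wx wy; apply: ball_eq => e e0.
have [m mP] := wx _ (half_gt0 e0).
have [n nP] := wy _ (half_gt0 e0).
have [a wa] := wP (maxn m n).
apply: (@ball_split _ _ (p a)).
  by apply: mP; exact: agreeW (leq_maxl m n) wa.
by apply/ball_sym/nP; exact: agreeW (leq_maxr m n) wa.
Qed.

(** A sequence in the family converging to [w] has an image under [p] that is
    Cauchy, so that any cluster point of this image is the limit. *)
Lemma limit_at_exists p w : finitely_determined p -> prefixed phi w ->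
  exists x, limit_at p w x.
Proof.
move=> pP wP.
have [a wa] := choice wP.
have [x [_ xP]] := X_compact (F := p \o a @ \oo) _ filterT.
exists x => e e0.
have [n nP] := pP _ (half_gt0 e0).
have [|_ [[m nm <-] xm]] := xP ((p \o a) @` [set m | (n <= m)%N]) _ _
    (nbhsx_ballx x _ (half_gt0 e0)).
  by exists n => // m nm; exists m.
exists n => b wb; apply: ball_split xm _.
by apply: nP; apply: agree_trans wb; apply: agree_sym; exact: agreeW nm (wa m).
Qed.

(** The order of the quantifiers is the point: [U] depends on the coding [phi]
    only, and serves all the maps [T] whose projection [p] the coding
    determines. *)
Lemma cantor_factor (sigma : A -> A) (s : nat -> nat) :
  (forall a, phi (sigma a) = phi a \o s) ->
  exists U : continuousType cantor_space cantor_space,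
    forall (T : continuousType X X) (p : A -> X), finitely_determined p ->
      (forall a, T (p a) = p (sigma a)) -> (forall x, exists a, p a = x) ->
      is_factor T U.
Proof.
move=> phis.
pose r : cantor_space -> cantor_space := retract phi a0.
have rP w : prefixed phi (r w) by exact: retract_prefixed.
pose U (w : cantor_space) : cantor_space := r w \o s.
have UP w : prefixed phi (U w).
  move=> n; have [m mP] := agree_reindex s n; have [a wa] := rP w m.
  by exists (sigma a); rewrite phis; exact: mP.
have Uc : continuous U.
  apply: cantor_continuous => n; have [m mP] := agree_reindex s n.
  by exists m => v w /(retract_nonexpansive phi a0) vw; exact: mP.
exists (mkcts Uc) => T p pP Tp psurj.
have [pi piP] := choice (fun w => limit_at_exists pP (rP w)).
have pic : continuous (pi : cantor_space -> X).
  move=> w; apply/cvg_ballP => e e0.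
  have [n nP] := piP w _ (half_gt0 e0).
  apply: filterS (nbhs_agree w n) => v /(retract_nonexpansive phi a0) vw.
  have [m mP] := piP v _ (half_gt0 e0).
  have [a va] := rP v (maxn n m).
  apply: (@ball_split _ _ (p a)).
    apply/nP/(agree_trans (agree_sym vw)); exact: agreeW (leq_maxl n m) va.
  by apply/ball_sym/mP; exact: agreeW (leq_maxr n m) va.
exists (mkcts pic); split.
  move=> x _; have [a <-] := psurj x; exists (phi a) => //=.
  have phiP : prefixed phi (phi a) by exists a.
  apply: (limit_at_unique phiP); last exact: limit_at_phi.
  by have := piP (phi a); rewrite /r retract_id.
(* Both sides are within [e / 2] of [p (sigma a)] when [phi a] is close to
   [r w]; this uses that [r] fixes [U w]. *)
apply/funext => w /=; apply: ball_eq => e e0.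
have /cvg_ballP/(_ _ (half_gt0 e0)) := @cts_fun _ _ T (pi w).
move=> /nbhs_ballP[d /= d0 dT].
have [n] := piP (U w) _ (half_gt0 e0).
rewrite {1}/r (retract_id _ (UP w)) => nP.
have [m mP] := agree_reindex s n.
have [k kP] := piP w d d0.
have [a wa] := rP w (maxn m k).
apply: (@ball_split _ _ (T (p a))).
  by apply/dT/kP; exact: agreeW (leq_maxr m k) wa.
rewrite Tp; apply/ball_sym/nP; rewrite phis.
by apply: mP; exact: agreeW (leq_maxl m k) wa.
Qed.

End extension.

(** * Finite nets *)

Lemma small_inv (R : realType) (e : R) :
  (0 < e -> exists k : nat, k.+1%:R^-1 < e)%R.
Proof.
move=> e0; have [k _ kP] := near_infty_natSinv_lt (PosNum e0).
by exists k; exact: (kP k (leqnn k)).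
Qed.

Lemma inv_gt0 (R : realType) (k : nat) : (0 < k.+1%:R^-1 :> R)%R.
Proof. by rewrite invr_gt0 ltr0Sn. Qed.

(** Covering by finitely many chosen neighbourhoods; only neighbourhoods relative
    to [A] are asked for, which is what continuity on a subspace provides. *)
Lemma compact_finite_nbhs (T : topologicalType) (A : set T) (V : T -> set T) :
  compact A -> (forall x, A x -> within A (nbhs x) (V x)) ->
  exists s : seq T, forall y, A y -> exists2 x, x \in s & V x y.
Proof.
move=> /compact_near_coveringP cA AV.
(* The finite lists of centres, eventually containing any given one. *)
pose G := filter_from setT (fun s : seq T => [set t : seq T | {subset s <= t}]).
have FG : Filter G.
  apply: filter_from_filter; first by exists [::].
  move=> s t _ _; exists (s ++ t) => // u /= stu.
  by split=> x xs; apply: stu; rewrite mem_cat xs ?orbT.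
have [//|] :=
    cA _ G (fun s y => A y -> exists2 x, x \in s & V x y) FG.
  move=> x Ax.
  exists ([set y | A y -> V x y], [set t : seq T | {subset [:: x] <= t}]).
    by split=> /=; [exact: AV|exists [:: x]].
  case=> y t /= [Vxy xt] Ay; exists x; last exact: Vxy.
  by apply: xt; rewrite inE.
move=> s _ sG; exists s => y Ay.
by have := sG s (fun _ => id) y Ay Ay.
Qed.

(** One bit for each ball of each of countably many finite nets: membership of
    the point in that ball. *)
Lemma bit_coding (R : realType) (X : metricType R) : compact [set: X] ->
  exists code : X -> nat -> bool, forall e : R, (0 < e)%R ->
    exists n, forall x y, agree n (code x) (code y) -> ball x e y.
Proof.
move=> cX.
have netP (k : nat) :
    exists L : seq X, forall y, exists2 x, x \in L & ball x k.+1%:R^-1%R y.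
  have [x _|L LP] := compact_finite_nbhs (V := fun x => ball x k.+1%:R^-1%R) cX.
    by apply: filterS (nbhsx_ballx x _ (inv_gt0 R k)).
  by exists L => y; exact: LP.
have [L LP] := choice netP.
pose near_net k l x :=
  if ohead (drop l (L k)) is Some z then `[< ball z k.+1%:R^-1%R x >]
  else false.
exists (fun x i =>
  if unpickle i is Some (k, l) then near_net k l x else false) => e e0.
have [k ke] := small_inv (half_gt0 e0).
pose bit (l : 'I_(size (L k))) := pickle (k, l : nat).
exists (\max_l (bit l).+1)%N => x y xy.
have [z zL zx] := LP k x.
have iz : (index z (L k) < size (L k))%N by rewrite index_mem.
have := xy _ (leq_bigmax (F := fun l => (bit l).+1) (Ordinal iz)).
rewrite pickleK /near_net (drop_nth z)//= nth_index// asboolT//.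
move=> /esym/asboolP zy.
by apply: (@ball_splitr _ _ z); exact: le_ball (ltW ke) _ _.
Qed.

(** * Approximation uniform over all powers *)

(** Uniform control of the powers says that the set of [T] whose powers are all
    uniformly close to those of [S] is a neighbourhood of [S] in [N]. *)
Lemma powers_net (R : realType) (X : metricType R)
    (N : set (continuousType X X)) (e : R) :
  (0 < e)%R -> compact N -> uniformly_controlled_powers N ->
  exists L : seq (continuousType X X), forall T, N T ->
    exists2 S, S \in L & forall i x, ball (iter i S x) e (iter i T x).
Proof.
move=> e0 cN ucN.
pose V (S : continuousType X X) :=
  [set T : continuousType X X | forall i x, ball (iter i S x) e (iter i T x)].
apply: (compact_finite_nbhs (V := V) cN) => S NS.
have entB : entourage [set fg : continuousType X X * continuousType X X |
    forall x, ball (fg.1 x) e (fg.2 x)].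
  exists [set fg : (X -> X) * (X -> X) | forall x, ball (fg.1 x) e (fg.2 x)] => //.
  exists [set xy : X * X | ball xy.1 e xy.2] => //.
  exact: (entourage_ball X (PosNum e0)).
rewrite nbhs_subspace_in//.
by apply: filterS (ucN S _ entB) => T ST i x; exact: ST.
Qed.

Lemma powers_dense (R : realType) (X : metricType R)
    (F : set (continuousType X X)) :
  (exists C : set (set (continuousType X X)),
      [/\ countable C,
          forall N, C N -> compact N /\ uniformly_controlled_powers N &
          F `<=` \bigcup_(N in C) N]) ->
  exists S : nat -> continuousType X X, forall T (e : R), F T -> (0 < e)%R ->
    exists m, forall i x, ball (iter i (S m) x) e (iter i T x).
Proof.
move=> [C [countC CP FC]].
have netP (Nk : set (continuousType X X) * nat) :
    exists L : seq (continuousType X X), C Nk.1 -> forall T, Nk.1 T ->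
      exists2 S, S \in L &
        forall i x, ball (iter i S x) Nk.2.+1%:R^-1%R (iter i T x).
  have [CN|nCN] := pselect (C Nk.1); last by exists [::].
  have [cN uN] := CP _ CN.
  by have [L LP] := powers_net (inv_gt0 R Nk.2) cN uN; exists L.
have [L LP] := choice netP.
pose D : set (continuousType X X) :=
  \bigcup_(N in C) \bigcup_k [set` L (N, k)].
have /countable_injP[f finj] : countable D.
  apply: bigcup_countable => // N _; apply: bigcup_countable => // k _.
  exact/finite_set_countable/finite_seq.
exists (pinv D f) => T e FT e0.
have [N CN NT] := FC _ FT.
have [k ke] := small_inv e0.
have [S SL ST] := LP (N, k) CN T NT.
have DS : S \in D by rewrite inE; exists N => //; exists k.
exists (f S) => i x.
have -> : pinv D f (f S) = S by exact: pinvKV.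
exact: le_ball (ltW ke) _ (ST i x).
Qed.

Theorem proposition4p15 (R : realType) (X : metricType R)
    (X_nonempty : [set: X] !=set0) (X_compact : compact [set: X])
    (F : set (continuousType X X))
    (F_covered : exists C : set (set (continuousType X X)),
      [/\ countable C,
          forall N, C N -> compact N /\ uniformly_controlled_powers N &
          F `<=` \bigcup_(N in C) N]) :
  exists U : continuousType cantor_space cantor_space,
    forall T : continuousType X X, F T -> is_factor T U.
Proof.
have [S SP] := powers_dense F_covered.
have [code codeP] := bit_coding X_compact.
have [x0 _] := X_nonempty.
pose phi (a : nat * X) (k : nat) :=
  if unpickle k is Some (m, i, l) then code (iter (i + a.1) (S m) a.2) l
  else false.
pose s (k : nat) :=
  if unpickle k is Some (m, i, l) then pickle (m : nat, i.+1, l : nat) else k.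
pose sigma (a : nat * X) := (a.1.+1, a.2).
have phis a : phi (sigma a) = phi a \o s.
  apply/funext => k; rewrite /phi /s /=.
  case E : (unpickle k) => [[[m i] l]|]; last by rewrite E.
  by rewrite pickleK addnS addSn.
have [U UP] := cantor_factor X_compact (0%N, x0) phis.
exists U => T FT; apply: (UP T (fun a => iter a.1 T a.2)) => //; last first.
  by move=> x; exists (0%N, x).
(* Three approximations: from [T] to [S m], between the two orbit points of
   [S m], and back to [T]. *)
move=> e e0.
have [n nP] := codeP _ (half_gt0 (half_gt0 e0)).
have [m mP] := SP T _ FT (half_gt0 (half_gt0 e0)).
pose bit (l : 'I_n) := pickle (m, 0%N, l : nat).
exists (\max_l (bit l).+1)%N => a b ab.
have Sab : ball (iter a.1 (S m) a.2) (e / 2 / 2)%R (iter b.1 (S m) b.2).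
  apply: nP => l ln.
  have := ab _ (leq_bigmax (F := fun l => (bit l).+1) (Ordinal ln)).
  by rewrite /phi pickleK !add0n.
apply: (@ball_split _ _ (iter b.1 (S m) b.2)).
  by apply: ball_splitr Sab; exact: mP.
apply: le_ball (mP _ _).
rewrite ler_pdivrMr// ler_peMr ?ler1n// ltW//.
exact: half_gt0.
Qed.
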